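(* Let $u\colon\mathbb{N}\to\mathbb{R}$ be a bounded nonnegative function. Then, for all $n\ge0$, $\mathrm{Dom}\,N_u$ is an invariant subspace of $\partial_n$, and moreover it holds on $\mathrm{Dom}\,N_u$ that $$N_u\partial_n=\partial_nN_u-u(n)\partial_n .$$
   Context: $\mathbb{N}$ is the set of nonnegative integers and $\Gamma$ the set of all finite subsets of $\mathbb{N}$; $\mathbf{1}_\sigma$ is the indicator function of $\sigma\in\Gamma$. $(\Omega,\mathscr{F},\mathbb{P})$ is a probability space and $Z=(Z_n)_{n\ge0}$ an independent sequence of random variables with $\mathbb{P}\{Z_n=\theta_n\}=p_n$, $\mathbb{P}\{Z_n=-1/\theta_n\}=q_n$, where $0<p_n<1$, $q_n=1-p_n$, $\theta_n=\sqrt{q_n/p_n}$, and $\mathscr{F}$ is the $\sigma$-field generated by $Z$. $\mathsf{L}^2(Z)=L^2(\Omega,\mathscr{F},\mathbb{P})$ (complex-valued), with inner product $\langle\xi,\eta\rangle=\mathbb{E}[\overline{\xi}\eta]$. Put $Z_\emptyset=1$ and $Z_\sigma=\prod_{i\in\sigma}Z_i$; $\{Z_\sigma\mid\sigma\in\Gamma\}$ is an orthonormal basis of $\mathsf{L}^2(Z)$ (the canonical ONB). For $k\in\mathbb{N}$, $\partial_k$ is the bounded operator on $\mathsf{L}^2(Z)$ with $\partial_kZ_\sigma=\mathbf{1}_\sigma(k)Z_{\sigma\setminus\{k\}}$, and its adjoint satisfies $\partial_k^*Z_\sigma=[1-\mathbf{1}_\sigma(k)]Z_{\sigma\cup\{k\}}$,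 for all $\sigma\in\Gamma$. For bounded nonnegative $u\colon\mathbb{N}\to\mathbb{R}$, the 1D-weighted number operator $N_u$ associated with $u$ is $N_u\xi=\sum_{k=0}^\infty u(k)\partial_k^*\partial_k\xi$, with domain $\mathrm{Dom}\,N_u$ the set of all $\xi\in\mathsf{L}^2(Z)$ for which this series converges in $\mathsf{L}^2(Z)$. *)

(* Defs.v *)
From HB Require Import structures.
From mathcomp Require Import all_boot all_order all_algebra finmap.
From mathcomp Require Import all_classical all_reals all_analysis.
From mathcomp Require Import ess_sup_inf complex ring_quotient ring lra.

Set Implicit Arguments.
Unset Strict Implicit.
Unset Printing Implicit Defensive.

Import Order.TTheory GRing.Theory Num.Theory.
Import numFieldNormedType.Exports.

Local Open Scope classical_set_scope.
Local Open Scope ring_scope.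
Local Open Scope complex_scope.
Local Open Scope quotient_scope.

Local Notation Re := (@complex.Re _).
Local Notation Im := (@complex.Im _).

Section SquareIntegrable.
Context d (T : measurableType d) (R : realType) (P : probability T R).

(* For a complex-valued f, E[|f|^2] = E[(Re f)^2] + E[(Im f)^2]: measurability
   and square-integrability are expressed on the real and imaginary parts. *)
Definition sqint : {pred T -> R[i]} :=
  [pred f | ((Re \o f : T -> R) \in Lfun P 2%:E) &&
            ((Im \o f : T -> R) \in Lfun P 2%:E)].

Lemma sqintP (f : T -> R[i]) :
  reflect ((Re \o f : T -> R) \in Lfun P 2%:E /\
           (Im \o f : T -> R) \in Lfun P 2%:E) (f \in sqint).
Proof. exact: andP. Qed.

Lemma Lfun2D (f g : T -> R) : f \in Lfun P 2%:E -> g \in Lfun P 2%:E ->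
  f \+ g \in Lfun P 2%:E.
Proof.
move=> hf hg; have p1 : (1 <= 2%:E :> \bar R)%E by rewrite lee_fin ler1n.
by have [_ h] := Lfun_addr_closed P p1; exact: h.
Qed.

Lemma Lfun2Z (a : R) (f : T -> R) : f \in Lfun P 2%:E ->
  (fun x => a * f x) \in Lfun P 2%:E.
Proof.
move=> hf; have := @Lfun_scale _ _ _ P f a 2 (ler1n _ _) hf.
by rewrite (_ : a \o* f = (fun x => a * f x))//; apply/funext => x /=; rewrite mulrC.
Qed.

Lemma sqint_submod_closed : submod_closed sqint.
Proof.
split=> [|a f g /sqintP[f1 f2] /sqintP[g1 g2]]; apply/sqintP; split.
- exact: Lfun_cst.
- exact: Lfun_cst.
- rewrite (_ : _ \o _ = (fun x => Re a * Re (f x)) \+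
      (fun x => - Im a * Im (f x)) \+ (Re \o g)).
    by do 2?apply: Lfun2D => //; exact: Lfun2Z.
  apply/funext => x /=; rewrite fctE /GRing.scale/=.
  by case: a (f x) (g x) => [? ?] [? ?] [? ?] /=; rewrite mulNr.
- rewrite (_ : _ \o _ = (fun x => Re a * Im (f x)) \+
      (fun x => Im a * Re (f x)) \+ (Im \o g)).
    by do 2?apply: Lfun2D => //; exact: Lfun2Z.
  apply/funext => x /=; rewrite fctE /GRing.scale/=.
  by case: a (f x) (g x) => [? ?] [? ?] [? ?] /=.
Qed.

HB.instance Definition _ :=
  GRing.isSubmodClosed.Build R[i] (T -> R[i]) sqint sqint_submod_closed.

Record sqfun := SqFun { sqfun_val :> T -> R[i]; _ : sqfun_val \in sqint }.

HB.instance Definition _ := [isSub for sqfun_val].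
HB.instance Definition _ := gen_eqMixin sqfun.
HB.instance Definition _ := [Choice of sqfun by <:].
HB.instance Definition _ := [SubChoice_isSubLmodule of sqfun by <:].

Lemma sqfunD (f g : sqfun) w : (f + g) w = f w + g w. Proof. by []. Qed.

Lemma sqfunZ (a : R[i]) (f : sqfun) w : (a *: f) w = a * f w. Proof. by []. Qed.

Definition null_fun : {pred sqfun} := [pred f : sqfun | `[< {ae P, forall x, f x = 0} >]].

Lemma null_funP (f : sqfun) :
  reflect {ae P, forall x, f x = 0} (f \in null_fun).
Proof. exact: asboolP. Qed.

Lemma null_fun_submod_closed : submod_closed null_fun.
Proof.
split=> [|a f g /null_funP f0 /null_funP g0]; apply/null_funP.
  by apply/aeW => x.
apply: filterS2 f0 g0 => x /= fx gx.
by rewrite -[LHS]/(a *: f x + g x) fx gx scaler0 addr0.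
Qed.

HB.instance Definition _ :=
  GRing.isSubmodClosed.Build R[i] sqfun null_fun null_fun_submod_closed.

(* Square-integrable functions modulo almost everywhere equality. *)
Definition L2 : Type := Quotient.quot null_fun.
HB.instance Definition _ := GRing.Zmodule.on L2.
HB.instance Definition _ := ZmodQuotient.on L2.


Lemma L2_piD (f g : sqfun) : \pi_L2 (f + g) = \pi_L2 f + \pi_L2 g.
Proof. exact: Quotient.pi_add. Qed.

Lemma L2_pi0 : \pi_L2 0 = 0.
Proof. by have := L2_piD 0 0; rewrite addr0 -{1}[\pi_L2 0]addr0 => /addrI. Qed.

Definition L2_scale (a : R[i]) (x : L2) : L2 := \pi_L2 (a *: repr x).

Lemma L2_eqP (f g : sqfun) :
  reflect {ae P, forall x, f x = g x} (\pi_L2 f == \pi_L2 g).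
Proof.
rewrite -Quotient.idealrBE; apply: (iffP (null_funP _)).
  by apply: filterS => x h; apply/subr0_eq.
by apply: filterS => x /= h; rewrite -[LHS]/(f x - g x) h subrr.
Qed.

Lemma L2_reprK (f : sqfun) : {ae P, forall x, repr (\pi_L2 f) x = f x}.
Proof. by apply/L2_eqP; rewrite reprK. Qed.

Lemma L2_scaleE (a : R[i]) (f : sqfun) :
  L2_scale a (\pi_L2 f) = \pi_L2 (a *: f).
Proof.
apply/eqP/L2_eqP; apply: filterS (L2_reprK f) => x /= h.
by rewrite -[LHS]/(a *: repr (\pi_L2 f) x) h.
Qed.

Let L2_scalerA (a b : R[i]) x : L2_scale a (L2_scale b x) = L2_scale (a * b) x.
Proof. by elim/quotW: x => f; rewrite (L2_scaleE b f) !L2_scaleE scalerA. Qed.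

Let L2_scale1r : left_id 1 L2_scale.
Proof. by elim/quotW=> f; rewrite L2_scaleE scale1r. Qed.

Let L2_scalerDr : right_distributive L2_scale +%R.
Proof.
move=> a; elim/quotW=> f; elim/quotW=> g.
by rewrite -L2_piD !L2_scaleE -L2_piD scalerDr.
Qed.

Let L2_scalerDl x : {morph L2_scale^~ x : a b / a + b >-> a + b}.
Proof.
by elim/quotW: x => f a b; rewrite !L2_scaleE -L2_piD scalerDl.
Qed.

HB.instance Definition _ := GRing.Zmodule_isLmodule.Build R[i] L2
  L2_scalerA L2_scale1r L2_scalerDr L2_scalerDl.

Definition mean (X : T -> R) : R := fine 'E_P[X].

Definition cmean (X : T -> R[i]) : R[i] := mean (Re \o X) +i* mean (Im \o X).

(* Conjugate-linear in the first argument: <x, y> = E[conj(x) y]. *)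
Definition inner (x y : L2) : R[i] := cmean (fun w => (repr x w)^* * repr y w).

Lemma mean_ae_eq (X Y : T -> R) : X \in Lfun P 1 -> Y \in Lfun P 1 ->
  {ae P, forall w, X w = Y w} -> mean X = mean Y.
Proof.
move=> /Lfun1_integrable/measurable_int mX /Lfun1_integrable/measurable_int mY XY.
rewrite /mean unlock; congr fine; apply: ae_eq_integral => //.
by apply: filterS XY => w h _; rewrite /= h.
Qed.

Lemma meanD (X Y : T -> R) : X \in Lfun P 1 -> Y \in Lfun P 1 ->
  mean (X \+ Y) = mean X + mean Y.
Proof.
by move=> hX hY; rewrite /mean expectationD// fineD// expectation_fin_num.
Qed.

Lemma meanZ (a : R) (X : T -> R) : X \in Lfun P 1 ->
  mean (fun w => a * X w) = a * mean X.
Proof.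
move=> hX; have -> : (fun w => a * X w) = a \o* X.
  by apply/funext => w /=; rewrite mulrC.
by rewrite /mean expectationZl// fineM// expectation_fin_num.
Qed.

Lemma sqfunRe (f : sqfun) : (fun w => Re (f w)) \in Lfun P 2%:E.
Proof. by case: f => f /= /sqintP[]. Qed.

Lemma sqfunIm (f : sqfun) : (fun w => Im (f w)) \in Lfun P 2%:E.
Proof. by case: f => f /= /sqintP[]. Qed.

Lemma Lfun1D (X Y : T -> R) : X \in Lfun P 1 -> Y \in Lfun P 1 ->
  (fun w => X w + Y w) \in Lfun P 1.
Proof. by have [_ h] := Lfun_addr_closed P (lexx 1%E) => hX hY; exact: h. Qed.

Lemma Lfun1Z (a : R) (X : T -> R) : X \in Lfun P 1 ->
  (fun w => a * X w) \in Lfun P 1.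
Proof.
move=> hX; have := @Lfun_scale _ _ _ P X a 1 (lexx _) hX.
by rewrite (_ : a \o* X = (fun w => a * X w))//; apply/funext => w /=; rewrite mulrC.
Qed.

Definition rdot_fun (f g : sqfun) w := Re (f w) * Re (g w) + Im (f w) * Im (g w).

Definition idot_fun (f g : sqfun) w := Re (f w) * Im (g w) + -1 * (Im (f w) * Re (g w)).

Lemma rdot_Lfun1 f g : rdot_fun f g \in Lfun P 1.
Proof.
by apply: Lfun1D; apply: Lfun2_mul_Lfun1; rewrite ?sqfunRe ?sqfunIm.
Qed.

Lemma idot_Lfun1 f g : idot_fun f g \in Lfun P 1.
Proof.
by apply: Lfun1D; [|apply: Lfun1Z]; apply: Lfun2_mul_Lfun1;
  rewrite ?sqfunRe ?sqfunIm.
Qed.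

Lemma inner_pi (f g : sqfun) :
  inner (\pi_L2 f) (\pi_L2 g) = mean (rdot_fun f g) +i* mean (idot_fun f g).
Proof.
rewrite /inner /cmean.
have -> : Re \o (fun w => (repr (\pi_L2 f) w)^* * repr (\pi_L2 g) w) =
    rdot_fun (repr (\pi_L2 f)) (repr (\pi_L2 g)).
  apply/funext => w; rewrite /rdot_fun /=.
  by case: (repr (\pi_L2 f) w) (repr (\pi_L2 g) w) => ? ? [? ?] /=; ring.
have -> : Im \o (fun w => (repr (\pi_L2 f) w)^* * repr (\pi_L2 g) w) =
    idot_fun (repr (\pi_L2 f)) (repr (\pi_L2 g)).
  apply/funext => w; rewrite /idot_fun /=.
  by case: (repr (\pi_L2 f) w) (repr (\pi_L2 g) w) => ? ? [? ?] /=; ring.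
congr (_ +i* _); apply: mean_ae_eq; rewrite ?rdot_Lfun1 ?idot_Lfun1//;
  by apply: filterS2 (L2_reprK f) (L2_reprK g) => w /=;
  rewrite /rdot_fun /idot_fun => -> ->.
Qed.

Definition rdot (f g : sqfun) : R := mean (rdot_fun f g).

Lemma rdotC f g : rdot f g = rdot g f.
Proof.
by congr mean; apply/funext => w; rewrite /rdot_fun !(mulrC (_ (f w))).
Qed.

Lemma rdotDl f g h : rdot (f + g) h = rdot f h + rdot g h.
Proof.
rewrite /rdot -meanD ?rdot_Lfun1//; congr mean; apply/funext => w.
rewrite /rdot_fun sqfunD /=.
by case: (f w) (g w) (h w) => ? ? [? ?] [? ?] /=; ring.
Qed.

Lemma rdotZl (a : R) f g : rdot (a%:C *: f) g = a * rdot f g.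
Proof.
rewrite /rdot -meanZ ?rdot_Lfun1//; congr mean; apply/funext => w.
rewrite /rdot_fun sqfunZ -[a%:C]/(a +i* 0). rewrite /=.
by case: (f w) (g w) => ? ? [? ?] /=; ring.
Qed.

Lemma rdotDr f g h : rdot h (f + g) = rdot h f + rdot h g.
Proof. by rewrite rdotC rdotDl !(rdotC h). Qed.

Lemma rdotZr (a : R) f g : rdot g (a%:C *: f) = a * rdot g f.
Proof. by rewrite rdotC rdotZl (rdotC g). Qed.

Lemma rdot_ge0 f : 0 <= rdot f f.
Proof.
rewrite /rdot /mean; apply/fine_ge0/expectation_ge0 => w.
by rewrite addr_ge0// -expr2 sqr_ge0.
Qed.

Lemma rdot_cauchy_schwarz f g : rdot f g ^+ 2 <= rdot f f * rdot g g.
Proof.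
set a := rdot f f; set b := rdot f g; set c := rdot g g.
have key s t : 0 <= s ^+ 2 * a + 2 * s * t * b + t ^+ 2 * c.
  have := rdot_ge0 (s%:C *: f + t%:C *: g).
  rewrite rdotDl !rdotDr !rdotZl !rdotZr (rdotC g f) -/a -/b -/c => h.
  by apply: le_trans h _; rewrite le_eqVlt; apply/orP; left; apply/eqP; ring.
have a0 : 0 <= a := rdot_ge0 f.
have c0 : 0 <= c := rdot_ge0 g.
have [c1|] := ltrP 0 c.
  have := key c (- b).
  have -> : c ^+ 2 * a + 2 * c * - b * b + (- b) ^+ 2 * c = c * (a * c - b ^+ 2).
    by ring.
  by rewrite pmulr_rge0// subr_ge0.
move=> c2; have cE : c = 0 by apply/le_anti; rewrite c0 c2.
have := key (b) (- (a + 1)); rewrite cE !mulr0 addr0.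
have -> : b ^+ 2 * a + 2 * b * - (a + 1) * b = - ((a + 2) * b ^+ 2) by ring.
by rewrite oppr_ge0 pmulr_rle0// ltr_wpDl.
Qed.

Definition l2norm (x : L2) : R[i] := (Num.sqrt (Re (inner x x)))%:C.

Lemma l2norm_pi f : l2norm (\pi_L2 f) = (Num.sqrt (rdot f f))%:C.
Proof. by rewrite /l2norm inner_pi. Qed.

Let l2norm_triangle x y : l2norm (x + y) <= l2norm x + l2norm y.
Proof.
elim/quotW: x => f; elim/quotW: y => g; rewrite -L2_piD !l2norm_pi.
rewrite -rmorphD lecR -(@ler_pXn2r _ 2) ?nnegrE ?addr_ge0 ?sqrtr_ge0//.
rewrite sqrrD !sqr_sqrtr ?rdot_ge0// rdotDl !rdotDr.
rewrite (rdotC g f).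
have : rdot f g <= Num.sqrt (rdot f f) * Num.sqrt (rdot g g).
  rewrite -sqrtrM ?rdot_ge0// (le_trans (ler_norm _))// -sqrtr_sqr ler_wsqrtr//.
  exact: rdot_cauchy_schwarz.
lra.
Qed.

Let l2normZ (a : R[i]) x : l2norm (a *: x) = `|a| * l2norm x.
Proof.
elim/quotW: x => f.
rewrite -[a *: \pi_L2 f]/(L2_scale a (\pi_L2 f)) L2_scaleE !l2norm_pi normc_def.
rewrite -rmorphM -sqrtrM ?addr_ge0 ?sqr_ge0//; congr ((Num.sqrt _)%:C).
rewrite /rdot -meanZ ?rdot_Lfun1//; congr mean; apply/funext => w.
rewrite /rdot_fun sqfunZ /=.
by case: a (f w) => ? ? [? ?] /=; ring.
Qed.

Let l2norm_eq0 x : l2norm x = 0 -> x = 0.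
Proof.
elim/quotW: x => f; rewrite l2norm_pi => -[] /eqP; rewrite sqrtr_eq0 => f0.
have {}f0 : rdot f f = 0 by apply/le_anti; rewrite f0 rdot_ge0.
have f_ge0 w : 0 <= rdot_fun f f w by rewrite addr_ge0// -expr2 sqr_ge0.
have /Lfun1_integrable ff := rdot_Lfun1 f f.
have : (\int[P]_w `|(EFin \o rdot_fun f f) w| = 0)%E.
  under eq_integral do rewrite gee0_abs ?lee_fin//.
  rewrite -[LHS]fineK; last exact: integrable_fin_num ff.
  by move: f0; rewrite /rdot /mean unlock => ->.
move/(ae_eq_integral_abs P measurableT (measurable_int _ ff)) => h.
have -> : 0 = \pi_L2 0 by rewrite L2_pi0.
apply/eqP/L2_eqP; apply: filterS h => w /(_ I) [].
rewrite /rdot_fun -!expr2 => /eqP.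
rewrite paddr_eq0 ?sqr_ge0// !sqrf_eq0 => /andP[/eqP re0 /eqP im0].
by apply/eqP; rewrite eq_complex re0 im0 !eqxx.
Qed.

(* Norm and topology of L2; the norm takes its (real) values in R[i], as
   required for a normed module over R[i]. *)
HB.instance Definition _ := Lmodule_isNormed.Build R[i] L2
  l2norm_triangle l2normZ l2norm_eq0.

End SquareIntegrable.

Arguments inner {d T R P}.

Section BernoulliNoise.
Context d (T : measurableType d) (R : realType) (P : probability T R).

Definition mutually_independent (X : nat -> {RV P >-> R}) : Prop :=
  forall (J : {fset nat}) (B : nat -> set R),
    (forall j, measurable (B j)) ->
    P (\bigcap_(j in [set` J]) X j @^-1` B j) =
    (\prod_(j <- J) P (X j @^-1` B j))%E.

Definition theta (p : nat -> R) (n : nat) : R := Num.sqrt ((1 - p n) / p n).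

(* The last field says that the sigma-algebra of the probability space is the
   one generated by the sequence Z. *)
Record bernoulli_noise (p : nat -> R) (Z : nat -> {RV P >-> R}) : Prop :=
  BernoulliNoise {
    noise_p01 : forall n, 0 < p n < 1;
    noise_pos : forall n, P (Z n @^-1` [set theta p n]) = (p n)%:E;
    noise_neg : forall n, P (Z n @^-1` [set - (theta p n)^-1]) = (1 - p n)%:E;
    noise_indep : mutually_independent Z;
    noise_generates : (@measurable d T) =
      <<s [set A | exists n (B : set R), measurable B /\ A = Z n @^-1` B] >> }.

Definition Zprod (Z : nat -> {RV P >-> R}) (s : {fset nat}) (w : T) : R :=
  \prod_(i <- s) Z i w.

Lemma noise_ae_bounded p Z (HZ : bernoulli_noise p Z) n :
  exists C : R, {ae P, forall w, `|Z n w| <= C}.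
Proof.
have /andP[p0 p1] := noise_p01 HZ n.
have th0 : 0 < theta p n by rewrite sqrtr_gt0 divr_gt0// subr_gt0.
set A := Z n @^-1` [set theta p n]; set B := Z n @^-1` [set - (theta p n)^-1].
have mA : measurable A by rewrite -[A]setTI; exact: measurable_funPT.
have mB : measurable B by rewrite -[B]setTI; exact: measurable_funPT.
have AB0 : A `&` B = set0.
  apply/seteqP; split=> // w [/= E1 E2].
  have := th0; rewrite -{1}E1 E2 oppr_gt0 invr_lt0 => /lt_trans/(_ th0).
  by rewrite ltxx.
have PAB : P (A `|` B) = 1%E.
  transitivity (P A + P B)%E; first exact: measureU.
  by rewrite /A /B (noise_pos HZ) (noise_neg HZ) -EFinD addrC subrK.
exists (theta p n + (theta p n)^-1).
exists (~` (A `|` B)); split.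
- exact/measurableC/measurableU.
- by rewrite probability_setC ?PAB ?subee//; exact: measurableU.
- move=> w /= h AwBw; apply: h.
  have thV : 0 < (theta p n)^-1 by rewrite invr_gt0.
  case: AwBw => [->|->]; first by rewrite gtr0_norm// lerDl ltW.
  by rewrite normrN gtr0_norm// lerDr ltW.
Qed.

Lemma Zprod_ae_bounded p Z (HZ : bernoulli_noise p Z) (s : seq nat) :
  exists C : R, {ae P, forall w, `|\prod_(i <- s) Z i w| <= C}.
Proof.
elim: s => [|n s [C HC]].
  by exists 1; apply/aeW => w; rewrite big_nil normr1.
have [D HD] := noise_ae_bounded HZ n.
exists (D * C); apply: filterS2 HC HD => w hC hD.
by rewrite big_cons normrM ler_pM.
Qed.

Lemma Zprod_sqint p Z (HZ : bernoulli_noise p Z) (s : {fset nat}) :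
  (fun w => (Zprod Z s w)%:C) \in sqint P.
Proof.
apply/sqintP; split; last exact: Lfun_cst.
have mZ : measurable_fun setT (Zprod Z s) by exact: measurable_prod.
apply: (@Lfun_subset _ _ _ P 2%:E +oo%E) => //.
- by rewrite lee_fin ler1n.
- exact: leey.
- exact: fin_num_measure.
- exact: leey.
rewrite inE; apply/andP; split; rewrite inE//= /finite_norm unlock.
case: ifP => _; last exact: ltry.
have [C HC] := Zprod_ae_bounded HZ s.
apply: (@le_lt_trans _ _ C%:E); last exact: ltry.
by apply/ess_supP; apply: filterS HC => w; rewrite /= lee_fin.
Qed.

(* Z_s as an element of L2, with Z_s = \prod_(i in s) Z_i and Z_fset0 = 1. *)
Definition Zbasis p Z (HZ : bernoulli_noise p Z) (s : {fset nat}) : L2 P :=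
  \pi_(L2 P) (SqFun (Zprod_sqint HZ s)).

End BernoulliNoise.

Section Operators.
Context d (T : measurableType d) (R : realType) (P : probability T R).

Definition bounded_operator (A : L2 P -> L2 P) : Prop :=
  exists M : R, forall x, `|A x| <= M%:C * `|x|.

(* B is the adjoint of A. *)
Definition adjoint (A B : L2 P -> L2 P) : Prop :=
  forall x y, inner (B x) y = inner x (A y).

(* Linear subspace, not assumed to be topologically closed. *)
Definition invariant_subspace (A : L2 P -> L2 P) (V : set (L2 P)) : Prop :=
  [/\ V 0, (forall (a : R[i]) x y, V x -> V y -> V (a *: x + y)) &
      (forall x, V x -> V (A x))].

Variables (D Dstar : nat -> {linear L2 P -> L2 P}) (u : nat -> R).

Definition number_series (x : L2 P) : nat -> L2 P :=
  series (fun k => (u k)%:C *: Dstar k (D k x)).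

Definition number_dom : set (L2 P) := [set x | cvgn (number_series x)].

(* Only meaningful on number_dom: lim is a default value elsewhere. *)
Definition number_op (x : L2 P) : L2 P := limn (number_series x).

End Operators.

(* Main.v *)
(* The products Z_s form a total orthonormal family of L2: orthonormality comes
   from independence, and totality from the fact that a function of the
   two-valued variable Z_i is affine in Z_i, so that a vector orthogonal to all
   Z_s has integral zero on every cylinder, hence (Dynkin) on every measurable
   set. Testing against the Z_s determines the action of the adjoints on the
   basis and yields D_n D*_k D_k = D*_k D_k D_n + [k = n] D_n. Hence the m-th
   partial sum of the number series at D_n x equals D_n of the m-th partial sum
   at x, minus u(n) D_n x as soon as n < m, and D_n is continuous. *)
Require Import Defs.
From mathcomp Require Import all_boot all_order all_algebra finmap.
From mathcomp Require Import all_classical all_reals all_analysis.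
From mathcomp Require Import complex measurable_realfun ring.

Set Implicit Arguments.
Unset Strict Implicit.
Unset Printing Implicit Defensive.

Import Order.TTheory GRing.Theory Num.Theory.
Import numFieldNormedType.Exports.

Local Open Scope classical_set_scope.
Local Open Scope ring_scope.
Local Open Scope complex_scope.

Local Notation Re := (@complex.Re _).
Local Notation Im := (@complex.Im _).

(** * Expectations of products of almost surely bounded variables *)

Section MeanProducts.
Context d (T : measurableType d) (R : realType) (P : probability T R).
Implicit Types X Y h : T -> R.

Definition ae_bounded X := exists C : R, {ae P, forall w, `|X w| <= C}.

Lemma Lfun_measurable q X : X \in Lfun P q -> measurable_fun setT X.
Proof. by move=> /sub_Lfun_mfun; rewrite inE. Qed.

Lemma Lfun1M_ae_bounded X h : measurable_fun setT X -> ae_bounded X ->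
  h \in Lfun P 1 -> (fun w => X w * h w) \in Lfun P 1.
Proof.
move=> mX [C XC] hh; have mh := Lfun_measurable hh.
have mXh : measurable_fun setT (fun w => X w * h w) by exact: measurable_funM.
apply/Lfun1_integrable/integrableP; split; first exact/measurable_EFinP.
have /Lfun1_integrable/integrableP[_ Ch] := Lfun1Z C hh.
apply: le_lt_trans Ch; apply: ae_ge0_le_integral => //.
- exact/measurableT_comp/measurable_EFinP.
- apply/measurableT_comp => //; apply/measurable_EFinP.
  exact: measurable_funM.
- apply: filterS XC => w XwC _ /=; rewrite lee_fin !normrM ler_wpM2r//.
  exact: le_trans XwC (ler_norm _).
Qed.

Lemma Lfun1_prodM (I : eqType) (s : seq I) (X : I -> T -> R) h :
  {in s, forall i, measurable_fun setT (X i) /\ ae_bounded (X i)} ->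
  h \in Lfun P 1 -> (fun w => (\prod_(i <- s) X i w) * h w) \in Lfun P 1.
Proof.
elim: s => [|i s IH] HX hh.
  by rewrite (_ : (fun _ => _) = h)//; apply/funext => w; rewrite big_nil mul1r.
have [mX bX] := HX _ (mem_head _ _).
rewrite (_ : (fun _ => _) = (fun w => X i w * ((\prod_(i <- s) X i w) * h w))).
  apply: Lfun1M_ae_bounded => //; apply: IH => // j js.
  by apply: HX; rewrite inE js orbT.
by apply/funext => w; rewrite big_cons mulrA.
Qed.

(* Multilinearity: a product formula that holds for all choices among two
   spanning variables [e i true], [e i false] at each index extends to their
   linear combinations. *)
Lemma mean_prod_span (I : eqType) (s : seq I) (e : I -> bool -> T -> R)
    (m : I -> bool -> R) (X : I -> T -> R) (a b : I -> R) h (c : R) :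
  uniq s ->
  (forall i k, measurable_fun setT (e i k)) ->
  (forall i k, ae_bounded (e i k)) ->
  (forall i, measurable_fun setT (X i)) ->
  (forall i, ae_bounded (X i)) ->
  (forall i, {ae P, forall w, X i w = a i * e i true w + b i * e i false w}) ->
  h \in Lfun P 1 ->
  (forall k : I -> bool, mean P (fun w => (\prod_(i <- s) e i (k i) w) * h w) =
     c * \prod_(i <- s) m i (k i)) ->
  mean P (fun w => (\prod_(i <- s) X i w) * h w) =
  c * \prod_(i <- s) (a i * m i true + b i * m i false).
Proof.
move=> us me be mX bX Xe; elim: s us h c => [_ h c hh /(_ xpredT)|].
  rewrite !big_nil => <-.
  by congr (mean P _); apply/funext => w; rewrite !big_nil.
move=> i s IH /= /andP[iNs us] h c hh H.
(* Absorbing [X i] into the weight lets the induction hypothesis apply with [X i * h] for [h] and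
   [c * (a i * m i true + b i * m i false)] for [c]. *)
have hi : (fun w => X i w * h w) \in Lfun P 1 by exact: Lfun1M_ae_bounded.
rewrite big_cons mulrA -(IH us _ _ hi).
  by congr (mean P _); apply/funext => w; rewrite big_cons mulrCA mulrA.
move=> k; pose ek w := \prod_(j <- s) e j (k j) w.
have hk v : (fun w => ek w * (e i v w * h w)) \in Lfun P 1.
  by apply: Lfun1_prodM => //; exact: Lfun1M_ae_bounded.
have Hk v : mean P (fun w => ek w * (e i v w * h w)) =
    c * (m i v * \prod_(j <- s) m j (k j)).
  (* The choice at [i] is forced to be [v]; as [i] is not in [s], the choices along [s] remain those
     of [k]. *)
  have := H (fun j => if j == i then v else k j).
  rewrite big_cons eqxx => E.
  transitivity (c * (m i v * \prod_(j <- s) m j (if j == i then v else k j))).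
    rewrite -E; congr (mean P _); apply/funext => w; rewrite big_cons eqxx.
    rewrite mulrCA mulrA /ek; congr (_ * _ * _); apply: eq_big_seq => j js.
    by case: eqP js => // ->; rewrite (negbTE iNs).
  congr (_ * (_ * _)); apply: eq_big_seq => j js.
  by case: eqP js => // ->; rewrite (negbTE iNs).
transitivity (mean P ((fun w => a i * (ek w * (e i true w * h w))) \+
                      (fun w => b i * (ek w * (e i false w * h w))))).
  apply: mean_ae_eq.
  - by apply: Lfun1_prodM.
  - by apply: Lfun1D; apply: Lfun1Z.
  - by apply: filterS (Xe i) => w /= ->; rewrite /ek; ring.
rewrite meanD ?Lfun1Z// !meanZ// !Hk; ring.
Qed.

End MeanProducts.

Lemma prod_indic (T I : choiceType) (R : comPzRingType) (J : {fset I}) (A : I -> set T) w :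
  \prod_(i <- J) (\1_(A i) w : R) = \1_(\bigcap_(i in [set` J]) A i) w.
Proof.
case: (pselect ((\bigcap_(i in [set` J]) A i) w)) => Aw.
  rewrite [RHS]indicE mem_set// big_seq big1// => i iJ.
  by rewrite indicE mem_set//; exact: Aw.
rewrite [RHS]indicE memNset//.
have /existsNP[i /not_implyP[/= iJ Aiw]] := Aw.
by rewrite (big_fsetD1 i)//= indicE memNset// mul0r.
Qed.

(** * Orthonormality and totality of the products [Zprod Z s] *)

Section Noise.
Context d (T : measurableType d) (R : realType) (P : probability T R).
Variables (p : nat -> R) (Z : nat -> {RV P >-> R}) (HZ : bernoulli_noise p Z).

Let val n (k : bool) : R := if k then theta p n else - (theta p n)^-1.
Let prb n (k : bool) : R := if k then p n else 1 - p n.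

Lemma theta_gt0 n : 0 < theta p n.
Proof.
by have /andP[? ?] := noise_p01 HZ n; rewrite sqrtr_gt0 divr_gt0// subr_gt0.
Qed.

Lemma theta_sqr n : theta p n ^+ 2 = (1 - p n) / p n.
Proof.
have /andP[? ?] := noise_p01 HZ n.
by rewrite sqr_sqrtr// ltW// divr_gt0// subr_gt0.
Qed.

Let valTF n : val n true != val n false.
Proof.
rewrite /val/= -subr_eq0 opprK gt_eqF// addr_gt0 ?theta_gt0//.
by rewrite invr_gt0 theta_gt0.
Qed.

Lemma noise_preimage_measurable n (B : set R) :
  measurable B -> measurable (Z n @^-1` B).
Proof. by move=> mB; rewrite -[X in measurable X]setTI; exact: measurable_funPT. Qed.

(** The two events are disjoint with probabilities [p n] and [1 - p n], so their union has full
    measure. *)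
Lemma noise_values n :
  {ae P, forall w, Z n w = theta p n \/ Z n w = - (theta p n)^-1}.
Proof.
set A := Z n @^-1` [set theta p n]; set B := Z n @^-1` [set - (theta p n)^-1].
have mA : measurable A by exact: noise_preimage_measurable.
have mB : measurable B by exact: noise_preimage_measurable.
have AB0 : A `&` B = set0.
  apply/seteqP; split=> // w [/= E1 E2]; have := valTF n.
  by rewrite /val -E2 -E1 eqxx.
have PAB : P (A `|` B) = 1%E.
  transitivity (P A + P B)%E; first exact: measureU.
  by rewrite /A /B (noise_pos HZ) (noise_neg HZ) -EFinD addrC subrK.
exists (~` (A `|` B)); split=> //.
- exact/measurableC/measurableU.
- by rewrite probability_setC ?PAB ?subee//; exact: measurableU.
Qed.

Lemma ae_bounded_indic (A : set T) : ae_bounded P (\1_A : T -> R).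
Proof.
by exists 1; apply/aeW => w; rewrite indicE; case: (_ \in _); rewrite ?normr1 ?normr0.
Qed.

(** Independence factors the probability of each joint choice of values. Almost surely [Z i ^+ r i]
    is a combination of the indicators of the two values of [Z i], so [mean_prod_span] carries the
    factorization over to powers. *)
Lemma noise_moment (J : {fset nat}) (r : nat -> nat) :
  mean P (fun w => \prod_(i <- J) Z i w ^+ r i) =
  \prod_(i <- J) (p i * theta p i ^+ r i + (1 - p i) * (- (theta p i)^-1) ^+ r i).
Proof.
pose A i k := Z i @^-1` [set val i k].
have mA i k : measurable (A i k) by exact: noise_preimage_measurable.
transitivity (mean P (fun w => (\prod_(i <- J) Z i w ^+ r i) * 1)).
  by congr (mean P _); apply/funext => w; rewrite mulr1.
have := @mean_prod_span _ _ _ P nat J (fun i k => \1_(A i k)) prb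
  (fun i w => Z i w ^+ r i) (fun i => val i true ^+ r i)
  (fun i => val i false ^+ r i) (cst 1) 1.
rewrite mul1r => -> //; first by apply: eq_bigr => i _; rewrite /prb /val; ring.
- exact: fset_uniq.
- by move=> i k; exact: ae_bounded_indic.
- by move=> i; exact: measurable_funX.
- move=> i; have [C ZC] := noise_ae_bounded HZ i.
  exists (C ^+ r i); apply: filterS ZC => w ZwC.
  by rewrite normrX lerXn2r ?nnegrE// (le_trans _ ZwC).
- move=> i; apply: filterS (noise_values i) => w Zw; rewrite !indicE /A.
  have TF := valTF i.
  case: Zw => [Zw|Zw].
    rewrite mem_set//= memNset ?mulr1 ?mulr0 ?addr0 ?Zw//=.
    by rewrite Zw -[theta p i]/(val i true); apply/eqP.
  rewrite [_ \in A i false]mem_set//= memNset ?mulr1 ?mulr0 ?add0r ?Zw//=.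
  by rewrite Zw -[- _]/(val i false); apply/eqP; rewrite eq_sym.
- exact: Lfun_cst.
move=> k; rewrite mul1r.
transitivity (mean P (\1_(\bigcap_(i in [set` J]) A i (k i)) : T -> R)).
  by congr (mean P _); apply/funext => w; rewrite mulr1 prod_indic.
rewrite /mean expectation_indic; last first.
  by apply: bigcap_measurableType => i _; exact: mA.
rewrite (noise_indep HZ J (B := fun i => [set val i (k i)]))//.
transitivity (fine (\prod_(j <- J) (prb j (k j))%:E)%E).
  congr fine; apply: eq_bigr => j _; rewrite /val /prb.
  by case: (k j); rewrite ?(noise_pos HZ) ?(noise_neg HZ).
by rewrite prodEFin.
Qed.

(** Exponents [0] and [1] bring products over different sets to a common index set, where they
    multiply factor by factor. *)
Lemma Zprod_widen (s t : {fset nat}) w : (s `<=` t)%fset ->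
  Zprod Z s w = \prod_(i <- t) Z i w ^+ (i \in s).
Proof.
move=> st; rewrite -(big_fset_incl _ st) => [|i _ /negbTE->//].
by apply: eq_big_seq => i ->.
Qed.

(** Over the union of [s] and [t] the mean factors into moments of single variables. As
    [theta^2 = (1 - p) / p], second moments are [1] and first moments [0], so one index in the
    symmetric difference kills the product. *)
Lemma Zprod_orthonormal (s t : {fset nat}) :
  mean P (fun w => Zprod Z s w * Zprod Z t w) = (s == t)%:R.
Proof.
transitivity (mean P (fun w => \prod_(i <- (s `|` t)%fset)
    Z i w ^+ ((i \in s) + (i \in t)))).
  congr (mean P _); apply/funext => w.
  rewrite (Zprod_widen _ (fsubsetUl s t)) (Zprod_widen _ (fsubsetUr s t)).
  by rewrite -big_split; apply: eq_bigr => i _; rewrite exprD.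
rewrite noise_moment; case: eqVneq => [->|st].
  rewrite fsetUid big_seq big1// => i ->; have /andP[p0 p1] := noise_p01 HZ i.
  rewrite sqrrN exprVn theta_sqr; field.
  by rewrite !gt_eqF// subr_gt0.
have [i ist] : exists i, (i \in s) != (i \in t).
  apply: contrapT => H; case/eqP: st; apply/fsetP => i; apply/eqP.
  by apply: contrapT => /negP ist; apply: H; exists i.
have iU : i \in (s `|` t)%fset.
  by rewrite inE; case: (i \in s) (i \in t) ist => [] [].
rewrite (big_fsetD1 i)//= (_ : _ + _ = 1)%N; last first.
  by case: (i \in s) (i \in t) ist => [] [].
have /andP[p0 p1] := noise_p01 HZ i; have th := theta_gt0 i.
rewrite !expr1 (_ : _ + _ = 0) ?mul0r//.
have -> : p i * theta p i + (1 - p i) * - (theta p i)^-1 =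
    (p i * theta p i ^+ 2 - (1 - p i)) / theta p i by field; rewrite gt_eqF.
by rewrite theta_sqr mulrCA divff ?gt_eqF// mulr1 subrr mul0r.
Qed.

Lemma inner_Zbasis (s t : {fset nat}) :
  inner (Zbasis HZ s) (Zbasis HZ t) = (s == t)%:R.
Proof.
rewrite /Zbasis inner_pi.
have -> : rdot_fun (SqFun (Zprod_sqint HZ s)) (SqFun (Zprod_sqint HZ t)) =
    (fun w => Zprod Z s w * Zprod Z t w).
  by apply/funext => w; rewrite /rdot_fun/= mul0r addr0.
have -> : idot_fun (SqFun (Zprod_sqint HZ s)) (SqFun (Zprod_sqint HZ t)) = cst 0.
  by apply/funext => w; rewrite /idot_fun/=; ring.
rewrite Zprod_orthonormal (_ : mean P (cst 0) = 0); first by case: eqP.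
by rewrite /mean expectation_cst.
Qed.

(* Every function of the two-valued variable [Z i] is affine in [Z i], so
   orthogonality to the products [Zprod Z s] passes to cylinder sets, a
   pi-system generating the sigma-algebra. *)
Lemma mean_cylinder_eq0 (h : T -> R) : h \in Lfun P 1 ->
  (forall s, mean P (fun w => Zprod Z s w * h w) = 0) ->
  forall (J : {fset nat}) (B : nat -> set R), (forall j, measurable (B j)) ->
  mean P (fun w => \1_(\bigcap_(j in [set` J]) Z j @^-1` B j) w * h w) = 0.
Proof.
move=> hh H J B mB.
pose e i (k : bool) : T -> R := if k then Z i else cst 1.
pose ind i k : R := \1_(B i) (val i k).
(* [a i] and [b i] are the slope and intercept of the affine function agreeing with the indicator of
   [B i] at both values of [Z i]. *)
pose a i : R := (ind i true - ind i false) / (val i true - val i false).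
pose b i : R := ind i true - a i * val i true.
under eq_fun do rewrite -prod_indic.
rewrite (@mean_prod_span _ _ _ P nat J e (fun _ _ => 0)
  (fun i => \1_(Z i @^-1` B i)) a b h 0) ?mul0r//.
- exact: fset_uniq.
- move=> i []; first exact: noise_ae_bounded HZ i.
  by exists 1; apply/aeW => w; rewrite normr1.
- by move=> i; apply: measurable_indic; exact: noise_preimage_measurable.
- by move=> i; exact: ae_bounded_indic.
- move=> i; apply: filterS (noise_values i) => w Zw; have TF := valTF i.
  rewrite -subr_eq0 in TF.
  have key k : ind i k = a i * val i k + b i * 1.
    by case: k; rewrite /b /a; field.
  rewrite -[LHS]/(\1_(B i) (Z i w)) /e /=.
  by case: Zw => ->; [exact: (key true)|exact: (key false)].
(* Taking [Z i] where [k i] holds and [1] elsewhere gives [Zprod] over a subset of [J], whose mean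
   against [h] is zero; hence the constants [0] above. *)
- move=> k; rewrite -(H [fset i in J | k i]%fset); congr (mean P _).
  apply/funext => w; rewrite (@Zprod_widen _ J); last exact: fset_sub.
  congr (_ * _); apply: eq_big_seq => i iJ; rewrite !inE/= iJ/= /e.
  by case: (k i).
Qed.

(** The sets over which [h] integrates to zero form a Dynkin system containing the cylinders, hence
    all measurable sets; this forces [h] to vanish almost everywhere. *)
Lemma noise_total (h : T -> R) : h \in Lfun P 1 ->
  (forall s, mean P (fun w => Zprod Z s w * h w) = 0) ->
  {ae P, forall w, h w = 0}.
Proof.
move=> hh H; have /Lfun1_integrable ih := hh; have mh := measurable_int _ ih.
have int_indic A : measurable A ->
    (\int[P]_(w in A) (h w)%:E = (mean P (fun w => \1_A w * h w))%:E)%E.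
  move=> mA; have hA : (fun w => \1_A w * h w) \in Lfun P 1.
    by apply: Lfun1M_ae_bounded => //; exact: ae_bounded_indic.
  rewrite /mean fineK ?expectation_fin_num// unlock integral_mkcond.
  apply: eq_integral => w _; rewrite patchE indicE.
  by case: (w \in A); rewrite ?mul1r ?mul0r.
pose G := [set A | exists (J : {fset nat}) (B : nat -> set R),
  (forall j, measurable (B j)) /\ A = \bigcap_(j in [set` J]) Z j @^-1` B j].
have mG A : G A -> measurable A.
  move=> [J [B [mB ->]]]; apply: bigcap_measurableType => j _.
  exact: noise_preimage_measurable.
have GI : setI_closed G.
  move=> _ _ [J [B [mB ->]]] [K [C [mC ->]]].
  (* Padding with [setT] outside [J] and outside [K] makes the intersection a single cylinder over
     the union. *)
  exists (J `|` K)%fset, (fun j => (if j \in J then B j else setT) `&`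
     (if j \in K then C j else setT)); split.
    by move=> j; apply: measurableI; case: ifP.
  apply/seteqP; split=> w.
    by move=> [wB wC] j /= _; split; case: ifPn => // ?; [exact: wB|exact: wC].
  move=> wBC; split=> j /= jJ; have /= := wBC j;
    by rewrite inE jJ ?orbT => /(_ isT)[].
have genG : @measurable d T = <<s G>>.
  apply/seteqP; split; last first.
    by apply: smallest_sub => //; exact: sigma_algebra_measurable.
  rewrite (noise_generates HZ); apply: sub_smallest2r; first exact: smallest_sigma_algebra.
  move=> A [n [B [mB ->]]].
  exists [fset n]%fset, (fun=> B); split=> //.
  apply/seteqP; split=> [w wB j /=|w wB]; last by apply: (wB n); rewrite /= inE.
  by rewrite inE => /eqP ->.
(* The empty product is [1], which settles the whole space; complements are reduced to it below. *)
have intT : (\int[P]_w (h w)%:E = 0)%E.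
  rewrite int_indic// -[RHS]/(0%:E) -(H fset0); congr ((mean P _)%:E).
  by apply/funext => w; rewrite indicE mem_set// /Zprod big_seq_fset0.
have int0 A : measurable A -> (\int[P]_(w in A) (h w)%:E = 0)%E.
  rewrite {1}genG.
  apply: (@dynkin_induction _ _ G
    (fun A => \int[P]_(w in A) (h w)%:E = 0)%E genG GI) => {A}.
  - exact: intT.
  - move=> A GA; rewrite int_indic; last exact: mG.
    by case: GA => J [B [mB ->]]; rewrite mean_cylinder_eq0.
  - move=> S mS S0.
    have := @integral_setU _ _ _ P S (~` S) (EFin \o h) mS (measurableC mS).
    rewrite setUv => /(_ mh); rewrite /disj_set setICr eqxx => /(_ isT).
    by rewrite S0 add0e => <-.
  - move=> F mF tF F0; rewrite integral_bigcup//; first by apply: eseries0.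
    by apply: integrableS ih => //; exact: bigcup_measurable.
have h0 : ae_eq P setT (EFin \o h) (cst 0%E).
  apply: integral_ae_eq => // E _ mE.
  by rewrite integral_cst// mul0e; exact: int0.
by apply: filterS h0 => w /(_ I) [].
Qed.

(** The basis functions are real, so the two components of [inner] test the real and imaginary parts
    of [f] separately; both parts are integrable because [P] is finite. *)
Lemma Zbasis_total (x : L2 P) :
  (forall s, inner (Zbasis HZ s) x = 0) -> x = 0.
Proof.
elim/quotW: x => f H; rewrite -(L2_pi0 P); apply/eqP/L2_eqP.
have Hre s : mean P (fun w => Zprod Z s w * Re (f w)) = 0.
  have := H s; rewrite inner_pi => -[+ _] => E; rewrite -[RHS]E.
  by congr (mean P _); apply/funext => w; rewrite /rdot_fun/= mul0r addr0.
have Him s : mean P (fun w => Zprod Z s w * Im (f w)) = 0.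
  have := H s; rewrite inner_pi => -[_] E; rewrite -[RHS]E.
  by congr (mean P _); apply/funext => w; rewrite /idot_fun/= mul0r mulr0 addr0.
have L1 g : g \in Lfun P 2%:E -> g \in Lfun P 1.
  by apply: Lfun_subset12; exact: fin_num_measure.
apply: filterS2 (noise_total (L1 _ (sqfunRe f)) Hre)
  (noise_total (L1 _ (sqfunIm f)) Him) => w re0 im0.
by apply/eqP; rewrite eq_complex/= re0 im0 !eqxx.
Qed.

End Noise.

(** * Algebraic rules for the inner product *)

Section InnerProduct.
Context d (T : measurableType d) (R : realType) (P : probability T R).
Implicit Types x y z : L2 P.

Lemma innerDr x y z : inner x (y + z) = inner x y + inner x z.
Proof.
elim/quotW: x => f; elim/quotW: y => g; elim/quotW: z => h.
rewrite -L2_piD !inner_pi -/(rdot f (g + h)) rdotDr; congr (_ +i* _).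
rewrite -meanD ?idot_Lfun1//; congr (mean P _); apply/funext => w.
rewrite /idot_fun sqfunD /=.
by case: (f w) (g w) (h w) => ? ? [? ?] [? ?] /=; ring.
Qed.

Lemma inner_conj x y : inner y x = (inner x y)^*.
Proof.
elim/quotW: x => f; elim/quotW: y => g.
rewrite !inner_pi -/(rdot g f) rdotC; congr (_ +i* _).
rewrite -mulN1r -meanZ ?idot_Lfun1//; congr (mean P _); apply/funext => w.
by rewrite /idot_fun; ring.
Qed.

Lemma innerDl x y z : inner (x + y) z = inner x z + inner y z.
Proof. by rewrite !(inner_conj z) innerDr rmorphD. Qed.

Lemma inner0r x : inner x 0 = 0.
Proof. by apply: (addrI (inner x 0)); rewrite -innerDr !addr0. Qed.

Lemma innerBr x y z : inner x (y - z) = inner x y - inner x z.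
Proof. by apply: (addIr (inner x z)); rewrite -innerDr !subrK. Qed.

Lemma inner_boolr (b : bool) x y : inner x (b%:R *: y) = b%:R * inner x y.
Proof. by case: b; rewrite ?scale1r ?mul1r// scale0r mul0r inner0r. Qed.

Lemma inner_booll (b : bool) x y : inner (b%:R *: x) y = b%:R * inner x y.
Proof. by rewrite !(inner_conj y) inner_boolr rmorphM rmorph_nat. Qed.

Lemma adjoint_sym (A B : L2 P -> L2 P) : adjoint A B -> adjoint B A.
Proof. by move=> AB x y; rewrite inner_conj -AB -inner_conj. Qed.

End InnerProduct.

(** * Action of the operators on the basis and their commutation relation *)

Section CommutationRelations.
Context d (T : measurableType d) (R : realType) (P : probability T R).
Variables (p : nat -> R) (Z : nat -> {RV P >-> R}) (HZ : bernoulli_noise p Z).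
Variables (D Dstar : nat -> {linear L2 P -> L2 P}).
Hypothesis D_Zbasis : forall k (s : {fset nat}),
  D k (Zbasis HZ s) = (k \in s)%:R *: Zbasis HZ (s `\ k)%fset.
Hypothesis D_adjoint : forall k, adjoint (D k) (Dstar k).

Lemma Zbasis_ext (x y : L2 P) :
  (forall s, inner (Zbasis HZ s) x = inner (Zbasis HZ s) y) -> x = y.
Proof.
move=> H; apply/subr0_eq; apply: (Zbasis_total (HZ := HZ)) => s.
by rewrite innerBr H subrr.
Qed.

(** Tested against [Zbasis HZ t], this becomes a fact on finite sets: [k] is in [t] and removing it
    leaves [s] exactly when [k] is not in [s] and adding it gives [t]. *)
Lemma Dstar_Zbasis k (s : {fset nat}) :
  Dstar k (Zbasis HZ s) = (k \notin s)%:R *: Zbasis HZ (k |` s)%fset.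
Proof.
apply: Zbasis_ext => t; rewrite -(adjoint_sym (@D_adjoint k)) D_Zbasis.
rewrite inner_booll inner_boolr !inner_Zbasis -!natrM !mulnb; congr (_%:R).
congr nat_of_bool; apply/andP/andP => -[kt /eqP E].
  by rewrite -E fsetD1K// !inE eqxx.
by rewrite E !inE eqxx fsetU1K.
Qed.

Lemma DstarD_Zbasis k (s : {fset nat}) :
  Dstar k (D k (Zbasis HZ s)) = (k \in s)%:R *: Zbasis HZ s.
Proof.
rewrite D_Zbasis linearZ /= Dstar_Zbasis !inE eqxx /= scale1r.
by have [ks|_] := boolP (k \in s); rewrite ?scale0r ?fsetD1K.
Qed.

(** Adjunction moves every operator onto the basis vector, so [x] may be arbitrary. In the resulting
    dual relation all terms vanish if [n] is in [s]; otherwise adding [n] to [s] changes the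
    eigenvalue of [Dstar k] after [D k] only for [k = n]. *)
Lemma D_DstarD n k (x : L2 P) :
  D n (Dstar k (D k x)) = Dstar k (D k (D n x)) + (k == n)%:R *: D n x.
Proof.
apply: Zbasis_ext => s; rewrite innerDr inner_boolr.
rewrite -!D_adjoint -!(adjoint_sym (@D_adjoint _)) -!D_adjoint.
rewrite -inner_booll -innerDl; congr (inner _ x).
rewrite DstarD_Zbasis linearZ/= !Dstar_Zbasis linearZ/= linearZ/= DstarD_Zbasis.
have [ns|ns] := boolP (n \in s); first by rewrite !scale0r !scaler0 addr0.
rewrite !scale1r -scalerDl -natrD !inE; congr (_%:R *: _).
by case: eqVneq => [->|_]; [rewrite (negbTE ns)|rewrite addn0].
Qed.

End CommutationRelations.

(** * Continuity of bounded operators and passage to the limit in the series *)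

Lemma bounded_operator_continuous d (T : measurableType d) (R : realType)
  (P : probability T R) (A : {linear L2 P -> L2 P}) :
  bounded_operator A -> continuous A.
Proof.
move=> [M AM]; apply/linear_bounded_continuous/linear_boundedP.
(* The order on [R[i]] is partial: [M%:C] has to be real for large [r] to exceed it. *)
have MC : M%:C \is Num.real by rewrite complex_real.
near=> r => x; apply: le_trans (AM x) _; apply: ler_wpM2r; first exact: normr_ge0.
by near: r; exact: nbhs_pinfty_ge.
Unshelve. all: by end_near.
Qed.

Theorem theorem4p7 (R : realType) (d : measure_display) (Omega : measurableType d)
    (P : probability Omega R) (p : nat -> R) (Z : nat -> {RV P >-> R})
    (HZ : bernoulli_noise p Z)
    (D Dstar : nat -> {linear L2 P -> L2 P})
    (D_bounded : forall k, bounded_operator (D k))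
    (D_Zbasis : forall k (s : {fset nat}),
       D k (Zbasis HZ s) = (k \in s)%:R *: Zbasis HZ (s `\ k)%fset)
    (D_adjoint : forall k, adjoint (D k) (Dstar k))
    (u : nat -> R) (u_bounded : bounded_fun u) (u_ge0 : forall k, 0 <= u k)
    (n : nat) :
  invariant_subspace (D n) (number_dom D Dstar u) /\
  forall x : L2 P, number_dom D Dstar u x ->
    number_op D Dstar u (D n x) =
    D n (number_op D Dstar u x) - (u n)%:C *: D n x.
Proof.
have Dn_cont : continuous (D n) by exact: bounded_operator_continuous.
have seriesE x m : number_series D Dstar u x m =
    \sum_(0 <= k < m) (u k)%:C *: Dstar k (D k x) by [].
(* The partial sum runs over [k < m], so it contains the exceptional index [n] only when [n < m]. *)
have key x m : number_series D Dstar u (D n x) m =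
    D n (number_series D Dstar u x m) - (n < m)%:R *: ((u n)%:C *: D n x).
  (* Spreading the correction over [k] with a Kronecker factor allows a termwise comparison. *)
  rewrite !seriesE linear_sum/= (_ : _ *: _ =
    \sum_(0 <= k < m) (k == n)%:R *: ((u k)%:C *: D n x)); last first.
    elim: m => [|m IH]; first by rewrite big_nil scale0r.
    rewrite big_nat_recr//= -IH ltnS leq_eqVlt eq_sym.
    by case: eqVneq => [->|_]; rewrite ?ltnn ?scale0r ?addr0 ?add0r.
  rewrite -sumrB; apply: eq_bigr => k _.
  rewrite linearZ/= (D_DstarD D_Zbasis D_adjoint) scalerDr.
  by rewrite scalerA mulrC -scalerA addrK.
(* This gives both conclusions: existence of the limit is invariance of the domain, and its value is
   the operator identity. *)
have key_cvg x (l : L2 P) : number_series D Dstar u x @ \oo --> l ->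
    number_series D Dstar u (D n x) @ \oo --> D n l - (u n)%:C *: D n x.
  move=> xl; rewrite (_ : number_series D Dstar u (D n x) = (fun m =>
    D n (number_series D Dstar u x m) - (n < m)%:R *: ((u n)%:C *: D n x))).
    apply: cvgB; first exact: (continuous_cvg _ (Dn_cont _)).
    (* The correction is constant as soon as [m] exceeds [n]. *)
    apply: cvg_near_cst; near=> m.
    rewrite (_ : (n < m)%N) ?scale1r//.
    by near: m; exact: nbhs_infty_gt.
  exact/funext/key.
split; first split.
- rewrite /number_dom/= (_ : number_series _ _ _ _ = cst 0); first exact: is_cvg_cst.
  apply/funext => m; rewrite seriesE big1// => k _.
  by rewrite !linear0.
- move=> a x y xV yV; rewrite /number_dom/=.
  rewrite (_ : number_series _ _ _ _ =
    (fun m => a *: number_series D Dstar u x m) + number_series D Dstar u y).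
    by apply: is_cvgD => //; exact: is_cvgZr.
  apply/funext => m; rewrite fctE !seriesE scaler_sumr -big_split/=.
  by apply: eq_bigr => k _; rewrite !linearP.
- by move=> x xV; apply/cvg_ex; eexists; exact: (key_cvg _ _ xV).
- by move=> x xV; apply/cvg_lim; [exact: norm_hausdorff|exact: (key_cvg _ _ xV)].
Unshelve. all: by end_near.
Qed.
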